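(* For all $\mu_k\in[0,1000]$, $$\|\mathcal{L}_k^{-1}\|_{B(\ell^1)}\le1.45.$$
   Context: $\mu_k$ is a real number. $\ell^1$ is the space of real sequences $y=(y_j)_{j\ge0}$ with $\|y\|_{\ell^1}=|y_0|+2\sum_{j\ge1}|y_j|<\infty$ and $\|\cdot\|_{B(\ell^1)}$ is the induced operator norm. The operator $\mathcal{L}_k$, depending only on $\mu_k$, is given by $(\mathcal{L}_ky)_0=y_0+2\sum_{\ell\ge1}(-1)^\ell y_\ell$ and $(\mathcal{L}_ky)_j=\mu_ky_{j-1}+2j\,y_j-\mu_ky_{j+1}$ for $j\ge1$. The statement includes that $\mathcal{L}_k$ is boundedly invertible on $\ell^1$: for every $z\in\ell^1$ there is a unique $y\in\ell^1$ with $\mathcal{L}_ky=z$, and $\mathcal{L}_k^{-1}:z\mapsto y$ is bounded on $\ell^1$. *)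

(* Defs.v *)
From Stdlib Require Export Reals ClassicalEpsilon.
From Coquelicot Require Export Coquelicot.

Open Scope R_scope.

(** Coquelicot's [Series] is total, so finiteness of the norm is a separate
    predicate; [norm_ell1 y] is meaningful only under [in_ell1 y]. *)
Definition in_ell1 (y : nat -> R) : Prop :=
  ex_series (fun j => Rabs (y (S j))).

Definition norm_ell1 (y : nat -> R) : R :=
  Rabs (y 0%nat) + 2 * Series (fun j => Rabs (y (S j))).

Definition is_bounded_operator (T : (nat -> R) -> nat -> R) : Prop :=
  (forall z, in_ell1 z -> in_ell1 (T z)) /\
  (forall a z w, in_ell1 z -> in_ell1 w ->
     T (fun j => a * z j + w j) = (fun j => a * T z j + T w j)) /\
  (exists C, forall z, in_ell1 z -> norm_ell1 (T z) <= C * norm_ell1 z).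

Definition op_norm (T : (nat -> R) -> nat -> R) : Rbar :=
  Lub_Rbar (fun r => exists z, in_ell1 z /\ norm_ell1 z <= 1 /\
                               r = norm_ell1 (T z)).

(** The operator is unbounded on ell1 because of the term [2 j y_j], so it is
    defined on all sequences; row 0 uses [l = S i]. *)
Definition L (mu : R) (y : nat -> R) (j : nat) : R :=
  match j with
  | O => y 0%nat + 2 * Series (fun i => (-1) ^ (S i) * y (S i))
  | S i => mu * y i + 2 * INR (S i) * y (S i) - mu * y (S (S i))
  end.

(** [z |-> y] with [y] in ell1 and [L mu y = z]; arbitrary if there is no
    such [y]. *)
Definition Linv (mu : R) (z : nat -> R) : nat -> R :=
  epsilon (inhabits (fun _ => 0)) (fun y => in_ell1 y /\ L mu y = z).

(* Main.v *)
Require Import Defs.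
From Stdlib Require Import Factorial Lra Lia Psatz FunctionalExtensionality.

(** Rows [j >= 1] of [L mu y = z] are a three-term recurrence whose homogeneous
    solutions are Bessel sequences: [v n = (-1)^n I_n(mu)] decays, while any
    nonnegative solution [u] of [mu u_(n+1) = mu u_(n-1) + 2 n u_n] grows.
    Behind this stands an initial value problem: [y] lists Chebyshev
    coefficients of a solution of [f' + mu f = g'] on [[-1,1]], row 0 prescribes
    [f(-1)], and [v] is, up to a factor, the expansion of [exp (- mu (x + 1))].

    The inverse is assembled in two steps.  Rows [j >= 1] are solved by the
    Green kernel [u_min(n,j) I_max(n,j)] (up to sign), where [u] is started from
    [u_0 = 0] and scaled so that [mu (I_n u_(n+1) + I_(n+1) u_n)], which does
    not depend on [n], is 1; this constant is called the Casoratian below.  A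
    multiple of [v] then repairs row 0.  Since the signs of [v] are exactly those of
    row 0, row 0 of [v] equals the norm of [v]; hence the correction costs at
    most the defect in row 0, which is at most [|z_0|] plus the norm [N] of the
    Green solution.  Altogether the norm of [y] is at most [|z_0| + 2 N], and
    since every [z_j] with [j >= 1] has weight 2 in the norm of [z], the bound
    1.45 follows once every column of the Green kernel has norm at most 1.45
    ([green_column_bound]).

    The column bound rests on three facts.  The recurrence turns
    [2 n I_n] into the telescoping difference [mu (I_(n-1) - I_(n+1))], so the
    tail [n >= j] of column [j] contributes at most [2 / j]
    ([green_column_tail]).  A telescoping of the same kind for [u] bounds the
    head [n < j] by 1/2 when [j >= 2] ([growing_partial_sum]).  And [I_n]
    decreases in [n] ([bessel_I_decreasing]), which is what allows both bounds
    to be compared with the Casoratian.  For [j >= 3] this gives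
    [1/2 + 2/3 < 1.45]; the columns 1 and 2 need slightly sharper estimates.
    When [mu = 0] the rows [j >= 1] are diagonal and are solved directly.

    Uniqueness is an energy identity: a homogeneous solution with [y_0 = 0]
    satisfies [sum_(n <= N) 2 n y_n^2 = mu y_N y_(N+1)], whose right-hand side
    tends to 0. *)

(** * Series of real numbers *)

Lemma ex_series_Rmult (c : R) (a : nat -> R) :
  ex_series a -> ex_series (fun n => c * a n).
Proof. exact (ex_series_scal_l (K := R_AbsRing) (V := R_NormedModule) c a). Qed.

Lemma ex_series_Rplus (a b : nat -> R) :
  ex_series a -> ex_series b -> ex_series (fun n => a n + b n).
Proof. exact (ex_series_plus (K := R_AbsRing) (V := R_NormedModule) a b). Qed.

Lemma sum_n_S (a : nat -> R) (n : nat) : sum_n a (S n) = sum_n a n + a (S n).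
Proof. exact (sum_Sn a n). Qed.

Lemma ex_series_dominated (a b : nat -> R) :
  (forall n, Rabs (a n) <= b n) -> ex_series b -> ex_series a.
Proof.
  exact (ex_series_le (K := R_AbsRing) (V := R_CompleteNormedModule) a b).
Qed.

Lemma sum_n_nonneg (a : nat -> R) (n : nat) :
  (forall k, 0 <= a k) -> 0 <= sum_n a n.
Proof.
  intros Ha. induction n as [|n IH]; [rewrite sum_O; apply Ha|].
  rewrite sum_n_S. specialize (Ha (S n)). lra.
Qed.

Lemma sum_n_nonneg_mono (a : nat -> R) (n m : nat) :
  (forall k, 0 <= a k) -> sum_n a n <= sum_n a (n + m).
Proof.
  intros Ha. induction m as [|m IH]; [rewrite Nat.add_0_r; lra|].
  rewrite Nat.add_succ_r, sum_n_S. specialize (Ha (S (n + m))). lra.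
Qed.

Lemma term_le_sum_n (a : nat -> R) (n : nat) :
  (forall k, 0 <= a k) -> a n <= sum_n a n.
Proof.
  intros Ha. destruct n as [|n]; [rewrite sum_O; lra|].
  rewrite sum_n_S. pose proof (sum_n_nonneg a n Ha). lra.
Qed.

Lemma summable_of_bounded (a : nat -> R) (M : R) :
  (forall n, 0 <= a n) -> (forall n, sum_n a n <= M) ->
  ex_series a /\ Series a <= M.
Proof.
  intros Ha HM.
  assert (Hex : ex_series a).
  { assert (He : ex_finite_lim_seq (sum_n a)).
    { apply ex_finite_lim_seq_incr with M; [|exact HM].
      intros n. rewrite sum_n_S. specialize (Ha (S n)). lra. }
    destruct He as [l Hl]. exists l. exact Hl. }
  split; [exact Hex|].
  assert (Hl : is_lim_seq (sum_n a) (Series a)) by exact (Series_correct a Hex).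
  apply (is_lim_seq_le _ (fun _ => M) _ _ HM Hl (is_lim_seq_const M)).
Qed.

Lemma partial_sum_le_Series (a : nat -> R) (n : nat) :
  (forall k, 0 <= a k) -> ex_series a -> sum_n a n <= Series a.
Proof.
  intros Ha Hex.
  apply (is_lim_seq_incr_compare (sum_n a)).
  - exact (Series_correct a Hex).
  - intros k. rewrite sum_n_S. specialize (Ha (S k)). lra.
Qed.

Lemma term_le_Series (a : nat -> R) (n : nat) :
  (forall k, 0 <= a k) -> ex_series a -> a n <= Series a.
Proof.
  intros Ha Hex.
  apply Rle_trans with (1 := term_le_sum_n a n Ha).
  now apply partial_sum_le_Series.
Qed.

Lemma ell1_tail_ge0 (y : nat -> R) :
  in_ell1 y -> 0 <= Series (fun j => Rabs (y (S j))).
Proof.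
  intros Hy. apply Rle_trans with (Rabs (y 1%nat)); [apply Rabs_pos|].
  apply (term_le_Series (fun j => Rabs (y (S j))) 0); [|exact Hy].
  intros; apply Rabs_pos.
Qed.

Lemma sum_n_Series_swap (a : nat -> nat -> R) (N : nat) :
  (forall n, ex_series (a n)) ->
  ex_series (fun j => sum_n (fun n => a n j) N) /\
  sum_n (fun n => Series (a n)) N = Series (fun j => sum_n (fun n => a n j) N).
Proof.
  intros Ha. induction N as [|N [IHex IH]].
  - split.
    + apply ex_series_ext with (2 := Ha O). intros j. now rewrite sum_O.
    + rewrite sum_O. apply Series_ext. intros j. now rewrite sum_O.
  - assert (Hs : forall j, sum_n (fun n => a n j) N + a (S N) j
                           = sum_n (fun n => a n j) (S N))
      by (intros j; now rewrite sum_n_S).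
    split.
    + apply ex_series_ext with (1 := Hs). now apply ex_series_Rplus.
    + rewrite sum_n_S, IH, <- Series_plus by auto. apply Series_ext, Hs.
Qed.

Lemma Series_delta (z : nat -> R) (n : nat) :
  Series (fun j => (if (n =? j)%nat then 1 else 0) * z j) = z n.
Proof.
  apply is_series_unique.
  (* The partial sums are constant from index [n] on. *)
  change (is_lim_seq
    (sum_n (fun j => (if (n =? j)%nat then 1 else 0) * z j)) (z n)).
  apply (is_lim_seq_ext_loc (fun _ => z n)); [|apply is_lim_seq_const].
  exists n. intros N HN.
  assert (H : forall k, (if (n <=? k)%nat then z n else 0)
    = sum_n (fun j => (if (n =? j)%nat then 1 else 0) * z j) k).
  { induction k as [|k IH].
    - rewrite sum_O. destruct n; simpl; ring.
    - rewrite sum_n_S, <- IH.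
      destruct (Nat.eqb_spec n (S k)) as [Heq|Hne];
        destruct (Nat.leb_spec n k); destruct (Nat.leb_spec n (S k));
        try lia; rewrite <- ?Heq; ring. }
  rewrite <- H. apply Nat.leb_le in HN. now rewrite HN.
Qed.

(** * Modified Bessel functions *)

Definition bessel_term (mu : R) (n k : nat) : R :=
  (mu / 2) ^ (2 * k + n) / (INR (fact k) * INR (fact (n + k))).

(** The modified Bessel function of the first kind, at fixed argument [mu] and
    varying order [n]. *)
Definition bessel_I (mu : R) (n : nat) : R := Series (bessel_term mu n).

Lemma bessel_term_ge0 mu n k : 0 <= mu -> 0 <= bessel_term mu n k.
Proof.
  intros Hmu. unfold bessel_term.
  apply Rmult_le_pos; [apply pow_le; lra|].
  left. apply Rinv_0_lt_compat, Rmult_lt_0_compat; apply INR_fact_lt_0.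
Qed.

(** Dropping the factor [(n + k)!] leaves an exponential series. *)
Lemma bessel_ex_series mu n : 0 <= mu -> ex_series (bessel_term mu n).
Proof.
  intros Hmu.
  apply ex_series_dominated with
    (fun k => (mu / 2) ^ n * (/ INR (fact k) * ((mu / 2) ^ 2) ^ k)).
  - intros k. rewrite Rabs_pos_eq by (apply bessel_term_ge0; exact Hmu).
    unfold bessel_term. rewrite pow_add, pow_mult.
    pose proof (INR_fact_lt_0 k) as Hk.
    assert (H1 : 1 <= INR (fact (n + k))).
    { apply (le_INR 1). pose proof (lt_O_fact (n + k)); lia. }
    assert (Hp : 0 <= (mu / 2) ^ n * (((mu / 2) ^ 2) ^ k)).
    { apply Rmult_le_pos; repeat apply pow_le; lra. }
    unfold Rdiv. rewrite Rinv_mult.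
    assert (Hi : / INR (fact (n + k)) <= 1).
    { rewrite <- Rinv_1. apply Rinv_le_contravar; lra. }
    assert (Hk' : 0 < / INR (fact k)) by (apply Rinv_0_lt_compat; exact Hk).
    fold (mu / 2).
    replace (((mu / 2) ^ 2) ^ k * (mu / 2) ^ n
             * (/ INR (fact k) * / INR (fact (n + k))))
      with (((mu / 2) ^ n * (((mu / 2) ^ 2) ^ k) * / INR (fact k))
            * / INR (fact (n + k))) by ring.
    replace ((mu / 2) ^ n * (/ INR (fact k) * ((mu / 2) ^ 2) ^ k))
      with (((mu / 2) ^ n * (((mu / 2) ^ 2) ^ k) * / INR (fact k)) * 1) by ring.
    apply Rmult_le_compat_l; [|exact Hi].
    apply Rmult_le_pos; lra.
  - apply ex_series_Rmult.
    exists (exp ((mu / 2) ^ 2)).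
    apply is_series_ext with (2 := is_exp_Reals ((mu / 2) ^ 2)).
    intros k. rewrite pow_n_pow. unfold scal; simpl. unfold mult; simpl. ring.
Qed.

Lemma bessel_I_ge0 mu n : 0 <= mu -> 0 <= bessel_I mu n.
Proof.
  intros Hmu.
  apply Rle_trans with (1 := bessel_term_ge0 mu n 0 Hmu).
  apply term_le_Series; [|apply bessel_ex_series; exact Hmu].
  intros k; apply bessel_term_ge0; exact Hmu.
Qed.

Lemma bessel_I0_gt0 mu : 0 <= mu -> 0 < bessel_I mu 0.
Proof.
  intros Hmu.
  apply Rlt_le_trans with (bessel_term mu 0 0); [unfold bessel_term; simpl; lra|].
  apply term_le_Series; [|apply bessel_ex_series; exact Hmu].
  intros k; apply bessel_term_ge0; exact Hmu.
Qed.

(** Termwise, with the series of order [n + 2] shifted by one index: the two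
    outer coefficients differ by the factors [n + 1 + k] and [k], which leaves
    [n + 1]. *)
Lemma bessel_I_recurrence mu n : 0 <= mu ->
  mu * bessel_I mu n
  = 2 * INR (S n) * bessel_I mu (S n) + mu * bessel_I mu (S (S n)).
Proof.
  intros Hmu. unfold bessel_I.
  rewrite (Series_incr_1 (bessel_term mu n)) by (apply bessel_ex_series; exact Hmu).
  rewrite (Series_incr_1 (bessel_term mu (S n)))
    by (apply bessel_ex_series; exact Hmu).
  pose proof (bessel_ex_series mu (S n) Hmu) as He1.
  pose proof (bessel_ex_series mu (S (S n)) Hmu) as He2.
  apply (proj1 (ex_series_incr_1 (bessel_term mu (S n)))) in He1.
  assert (Heq : mu * Series (fun k => bessel_term mu n (S k))
    = 2 * INR (S n) * Series (fun k => bessel_term mu (S n) (S k))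
      + mu * Series (bessel_term mu (S (S n)))).
  { rewrite <- !Series_scal_l.
    rewrite <- Series_plus by (apply ex_series_Rmult; assumption).
    apply Series_ext. intros k. unfold bessel_term.
    replace (2 * S k + n)%nat with (S (2 * k + S n)) by lia.
    replace (2 * S k + S n)%nat with (S (S (2 * k + S n))) by lia.
    replace (2 * k + S (S n))%nat with (S (2 * k + S n)) by lia.
    replace (n + S k)%nat with (S (n + k)) by lia.
    replace (S n + S k)%nat with (S (S (n + k))) by lia.
    replace (S (S n) + k)%nat with (S (S (n + k))) by lia.
    rewrite <- !tech_pow_Rmult.
    set (p := (mu / 2) ^ (2 * k + S n)).
    rewrite (fact_simpl k), (fact_simpl (S (n + k))), !mult_INR, !S_INR, plus_INR.
    pose proof (INR_fact_neq_0 k). pose proof (INR_fact_neq_0 (S (n + k))).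
    pose proof (pos_INR k). pose proof (pos_INR n).
    field. repeat split; lra. }
  rewrite !Rmult_plus_distr_l, Heq.
  (* The shift leaves the zeroth terms over; they match on their own. *)
  assert (Hz : mu * bessel_term mu n 0 = 2 * INR (S n) * bessel_term mu (S n) 0).
  { unfold bessel_term.
    replace (2 * 0 + n)%nat with n by lia.
    replace (2 * 0 + S n)%nat with (S n) by lia.
    rewrite !Nat.add_0_r, <- tech_pow_Rmult, fact_simpl, mult_INR.
    set (p := (mu / 2) ^ n).
    pose proof (INR_fact_neq_0 n). pose proof (not_0_INR (S n)).
    simpl (fact 0). simpl (INR 1). field. split; [assumption|].
    apply not_0_INR; lia. }
  rewrite Hz. ring.
Qed.

(** By the recurrence [2 I_(j+1) <= 2 (j + 1) I_(j+1) = mu (I_j - I_(j+2))],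
    and the right-hand side telescopes. *)
Lemma bessel_partial_sum mu n : 0 <= mu ->
  sum_n (fun j => bessel_I mu (S j)) n
  <= mu / 2 * (bessel_I mu 0 + bessel_I mu 1).
Proof.
  intros Hmu.
  (* The two boundary terms are kept on the left so that the induction closes. *)
  assert (H : sum_n (fun j => bessel_I mu (S j)) n
    + mu / 2 * (bessel_I mu (S n) + bessel_I mu (S (S n)))
    <= mu / 2 * (bessel_I mu 0 + bessel_I mu 1)).
  { induction n as [|n IH].
    - rewrite sum_O. pose proof (bessel_I_recurrence mu 0 Hmu) as H.
      simpl (INR 1) in H. lra.
    - rewrite sum_n_S.
      pose proof (bessel_I_recurrence mu (S n) Hmu) as H.
      pose proof (bessel_I_ge0 mu (S (S n)) Hmu).
      assert (1 <= INR (S (S n))) by (apply (le_INR 1); lia).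
      nra. }
  pose proof (bessel_I_ge0 mu (S n) Hmu).
  pose proof (bessel_I_ge0 mu (S (S n)) Hmu). nra.
Qed.

Lemma bessel_I_summable mu : 0 <= mu -> ex_series (fun j => bessel_I mu (S j)).
Proof.
  intros Hmu.
  apply (summable_of_bounded _ (mu / 2 * (bessel_I mu 0 + bessel_I mu 1))).
  - intros n; apply bessel_I_ge0; exact Hmu.
  - intros n; apply bessel_partial_sum; exact Hmu.
Qed.

Lemma bessel_I_lim mu : 0 <= mu -> is_lim_seq (bessel_I mu) 0.
Proof.
  intros Hmu. apply is_lim_seq_incr_1.
  apply (ex_series_lim_0 (fun j => bessel_I mu (S j))).
  apply bessel_I_summable; exact Hmu.
Qed.

Lemma bessel_I_decr2 mu n : 0 < mu -> bessel_I mu (S (S n)) <= bessel_I mu n.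
Proof.
  intros Hmu.
  pose proof (bessel_I_recurrence mu n (Rlt_le _ _ Hmu)) as H.
  pose proof (bessel_I_ge0 mu (S n) (Rlt_le _ _ Hmu)).
  pose proof (pos_INR (S n)). nra.
Qed.

(** The recurrence alone only compares orders two apart.  The quantity
    [E_n = mu (I_n^2 - I_(n+1)^2) - 2 n I_n I_(n+1)], which is
    [mu (I_n^2 - I_(n-1) I_(n+1))] and thus a Turan determinant, satisfies
    [E_n + E_(n+1) = 2 I_n I_(n+1)].  Hence
    [E_n - E_(n+2) = 2 I_(n+1) (I_n - I_(n+2)) >= 0], and since [E] tends to 0
    it is nonnegative, which forces [I_(n+1) <= I_n]. *)
Lemma bessel_I_decreasing mu n : 0 < mu -> bessel_I mu (S n) <= bessel_I mu n.
Proof.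
  intros Hmu. assert (Hmu' := Rlt_le _ _ Hmu).
  set (I := bessel_I mu).
  set (E := fun n =>
    mu * (I n * I n - I (S n) * I (S n)) - 2 * INR n * (I n * I (S n))).
  assert (Hsum : forall m, E m + E (S m) = 2 * (I m * I (S m))).
  { intros m. unfold E. pose proof (bessel_I_recurrence mu m Hmu') as H.
    fold I in H.
    replace (mu * (I m * I m - I (S m) * I (S m))) with
      ((mu * I m) * I m - mu * (I (S m) * I (S m))) by ring.
    rewrite H.
    replace (I m * I (S m)) with (I (S m) * I m) by ring.
    replace (mu * (I (S m) * I (S m) - I (S (S m)) * I (S (S m)))) with
      (mu * (I (S m) * I (S m)) - mu * I (S (S m)) * I (S (S m))) by ring.
    replace (mu * I (S (S m))) with (mu * I m - 2 * INR (S m) * I (S m)) at 2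
      by (rewrite H; ring).
    rewrite S_INR in *. nra. }
  assert (Hstep : forall k, E (n + 2 * k)%nat <= E n).
  { induction k as [|k IH]; [rewrite Nat.mul_0_r, Nat.add_0_r; lra|].
    replace (n + 2 * S k)%nat with (S (S (n + 2 * k))) by lia.
    set (m := (n + 2 * k)%nat) in *.
    pose proof (Hsum m) as Hm. pose proof (Hsum (S m)) as HSm.
    pose proof (bessel_I_decr2 mu m Hmu) as Hd.
    pose proof (bessel_I_ge0 mu (S m) Hmu') as Hp.
    fold I in Hd, Hp. nra. }
  assert (Hlim : is_lim_seq E 0).
  { apply is_lim_seq_incr_1.
    (* The factor [2 (m + 1)] in [E_(m+1)] is absorbed by the recurrence. *)
    apply is_lim_seq_ext with (fun m =>
      mu * (I (S m) * I (S m) - I (S (S m)) * I (S (S m)))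
      - mu * (I m - I (S (S m))) * I (S (S m))).
    { intros m. unfold E. pose proof (bessel_I_recurrence mu m Hmu') as H.
      fold I in H.
      replace (mu * (I m - I (S (S m)))) with (mu * I m - mu * I (S (S m))) by ring.
      rewrite H. ring. }
    assert (L0 : is_lim_seq I 0) by (apply bessel_I_lim; exact Hmu').
    assert (L1 : is_lim_seq (fun m => I (S m)) 0)
      by (apply (is_lim_seq_incr_1 I); exact L0).
    assert (L2 : is_lim_seq (fun m => I (S (S m))) 0)
      by (apply (is_lim_seq_incr_1 (fun m => I (S m))); exact L1).
    replace (Finite 0) with (Finite (mu * (0 * 0 - 0 * 0) - mu * (0 - 0) * 0))
      by (f_equal; ring).
    apply is_lim_seq_minus'.
    - apply is_lim_seq_mult'; [apply is_lim_seq_const|].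
      apply is_lim_seq_minus'; apply is_lim_seq_mult'; assumption.
    - apply is_lim_seq_mult'; [|assumption].
      apply is_lim_seq_mult'; [apply is_lim_seq_const|].
      apply is_lim_seq_minus'; assumption. }
  assert (HE : 0 <= E n).
  { apply (is_lim_seq_le (fun k => E (n + 2 * k)%nat) (fun _ => E n) 0 (E n) Hstep).
    - apply (is_lim_seq_subseq E 0 (fun k => (n + 2 * k)%nat)); [|exact Hlim].
      apply eventually_subseq. intros k; lia.
    - apply is_lim_seq_const. }
  pose proof (bessel_I_ge0 mu n Hmu') as Hn.
  pose proof (bessel_I_ge0 mu (S n) Hmu') as HSn.
  fold I in Hn, HSn |- *. unfold E in HE.
  apply Rnot_lt_le. intros Hlt.
  assert (0 <= INR n * (I n * I (S n))) by (apply Rmult_le_pos; [apply pos_INR|nra]).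
  assert (I n * I n < I (S n) * I (S n)) by nra.
  nra.
Qed.

(** * The growing solution *)

Fixpoint growing_pair (mu : R) (n : nat) : R * R :=
  match n with
  | O => (0, / (mu * bessel_I mu 0))
  | S m => let p := growing_pair mu m in
           (snd p, fst p + 2 * INR (S m) / mu * snd p)
  end.

(** Starting at 0 makes the Green solutions vanish at index 0; the value at 1
    normalizes the Casoratian of [casoratian]. *)
Definition growing (mu : R) (n : nat) : R := fst (growing_pair mu n).

Lemma growing_recurrence mu n : 0 < mu ->
  mu * growing mu (S (S n))
  = mu * growing mu n + 2 * INR (S n) * growing mu (S n).
Proof.
  intros Hmu. unfold growing. cbn [growing_pair fst snd]. field. lra.
Qed.

Lemma growing_0 mu : growing mu 0 = 0.
Proof. reflexivity. Qed.

Lemma growing_ge0 mu n : 0 < mu -> 0 <= growing mu n.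
Proof.
  intros Hmu.
  assert (H : 0 <= growing mu n /\ 0 <= growing mu (S n)); [|apply H].
  induction n as [|n [IH1 IH2]].
  - split; [rewrite growing_0; lra|].
    left. apply Rinv_0_lt_compat, Rmult_lt_0_compat; [exact Hmu|].
    apply bessel_I0_gt0; lra.
  - split; [exact IH2|].
    pose proof (growing_recurrence mu n Hmu). pose proof (pos_INR (S n)).
    assert (0 <= INR (S n) * growing mu (S n)) by (apply Rmult_le_pos; assumption).
    assert (0 <= mu * growing mu n) by (apply Rmult_le_pos; lra).
    apply Rmult_le_reg_l with mu; lra.
Qed.

Lemma casoratian mu n : 0 < mu ->
  mu * (bessel_I mu n * growing mu (S n) + bessel_I mu (S n) * growing mu n) = 1.
Proof.
  intros Hmu. pose proof (bessel_I0_gt0 mu (Rlt_le _ _ Hmu)) as H0.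
  induction n as [|n IH].
  - rewrite growing_0. unfold growing. cbn [growing_pair fst snd]. field. lra.
  - rewrite <- IH.
    pose proof (bessel_I_recurrence mu n (Rlt_le _ _ Hmu)) as HI.
    pose proof (growing_recurrence mu n Hmu) as Hu.
    replace (mu * (bessel_I mu (S n) * growing mu (S (S n))
                   + bessel_I mu (S (S n)) * growing mu (S n)))
      with (bessel_I mu (S n) * (mu * growing mu (S (S n)))
            + mu * bessel_I mu (S (S n)) * growing mu (S n)) by ring.
    rewrite Hu.
    replace (mu * bessel_I mu (S (S n)))
      with (mu * bessel_I mu n - 2 * INR (S n) * bessel_I mu (S n)) by lra.
    ring.
Qed.

(** The right-hand side is chosen for its product with [I_(p+2)]: since
    [max (mu, 2 (p + 2)) I_(p+2) <= mu I_(p+1)], the Casoratian bounds this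
    product by 1.  The induction distinguishes which entry of the maximum is active:
    when it is [mu], the right-hand side increases by at least
    [2 (p + 2) u_(p+2) >= 4 u_(p+2)]; otherwise [u] already grows by the factor
    [2 (p + 2) / mu > 1]. *)
Lemma growing_partial_sum mu p : 0 < mu ->
  4 * sum_n (growing mu) (S p)
  <= mu * growing mu (S p)
     + Rmax mu (2 * INR (S (S p))) * growing mu (S (S p)).
Proof.
  intros Hmu.
  induction p as [|p IH].
  - rewrite sum_n_S, sum_O, growing_0.
    pose proof (growing_recurrence mu 0 Hmu) as H. rewrite growing_0 in H.
    pose proof (growing_ge0 mu 1 Hmu). pose proof (growing_ge0 mu 2 Hmu).
    simpl (INR 1) in H. replace (INR 2) with 2 by (simpl; ring).
    destruct (Rle_dec 4 mu).
    + assert (mu * growing mu 2 <= Rmax mu (2 * 2) * growing mu 2)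
        by (apply Rmult_le_compat_r; [assumption|apply Rmax_l]).
      nra.
    + assert (Hmax : 2 * 2 * growing mu 2 <= Rmax mu (2 * 2) * growing mu 2)
        by (apply Rmult_le_compat_r; [assumption|apply Rmax_r]).
      assert (mu * growing mu 2 = 2 * growing mu 1) by lra.
      (* After multiplication by [mu], the claim reads
         [4 mu <= mu^2 + 8]. *)
      assert (0 <= growing mu 1 * ((mu - 2) * (mu - 2) + 4))
        by (apply Rmult_le_pos; nra).
      apply Rmult_le_reg_l with mu; [assumption|].
      apply Rmult_le_compat_l with (r := mu) in Hmax; lra.
  - rewrite sum_n_S.
    set (u0 := growing mu (S p)) in *.
    pose proof (growing_recurrence mu (S p) Hmu) as H. fold u0 in H.
    pose proof (growing_ge0 mu (S p) Hmu) as P0. fold u0 in P0.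
    pose proof (growing_ge0 mu (S (S p)) Hmu) as P1.
    pose proof (growing_ge0 mu (S (S (S p))) Hmu) as P2.
    set (u1 := growing mu (S (S p))) in *.
    set (u2 := growing mu (S (S (S p)))) in *.
    rewrite (S_INR (S (S p))).
    assert (Hj : 2 <= INR (S (S p))) by (apply (le_INR 2); lia).
    set (j := INR (S (S p))) in *.
    destruct (Rle_dec (2 * j) mu) as [Hle|Hgt].
    + rewrite (Rmax_left mu (2 * j)) in IH by assumption.
      assert (mu * u2 <= Rmax mu (2 * (j + 1)) * u2)
        by (apply Rmult_le_compat_r; [assumption|apply Rmax_l]).
      nra.
    + rewrite (Rmax_right mu (2 * j)) in IH by lra.
      assert (2 * (j + 1) * u2 <= Rmax mu (2 * (j + 1)) * u2)
        by (apply Rmult_le_compat_r; [assumption|apply Rmax_r]).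
      assert (Hu : 2 * j * u1 <= mu * u2) by nra.
      assert (Hk : 4 * u1 <= mu * u1 + (2 * (j + 1) - mu) * u2).
      { apply Rmult_le_reg_l with mu; [assumption|].
        assert ((2 * (j + 1) - mu) * (2 * j * u1) <= (2 * (j + 1) - mu) * (mu * u2))
          by (apply Rmult_le_compat_l; lra).
        (* With [j = p + 2] it remains to see that
           [mu^2 - (2 j + 4) mu + 4 j^2 + 4 j >= 0]: complete the square. *)
        assert (0 <= u1 * ((mu - j - 2) * (mu - j - 2) + (3 * j * j - 4)))
          by (apply Rmult_le_pos; nra).
        nra. }
      nra.
Qed.

(** * The Green kernel *)

Definition green (mu : R) (n j : nat) : R :=
  if (n <=? j)%nat then growing mu n * bessel_I mu j
  else (-1) ^ (n + j) * (growing mu j * bessel_I mu n).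

Lemma green_le mu n j : (n <= j)%nat -> green mu n j = growing mu n * bessel_I mu j.
Proof. intros H. unfold green. apply Nat.leb_le in H. now rewrite H. Qed.

Lemma green_ge mu n j : (j <= n)%nat ->
  green mu n j = (-1) ^ (n + j) * (growing mu j * bessel_I mu n).
Proof.
  intros H. unfold green. destruct (Nat.leb_spec n j) as [Hle|_]; [|reflexivity].
  replace j with n by lia.
  replace (n + n)%nat with (2 * n)%nat by lia. rewrite pow_1_even. ring.
Qed.

(** Off the diagonal both branches solve the homogeneous recurrence; on the
    diagonal the jump between them is the Casoratian. *)
Lemma green_equation mu n j : 0 < mu ->
  mu * green mu n j + 2 * INR (S n) * green mu (S n) j - mu * green mu (S (S n)) j
  = if (S n =? j)%nat then 1 else 0.
Proof.
  intros Hmu.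
  pose proof (bessel_I_recurrence mu n (Rlt_le _ _ Hmu)) as HI.
  pose proof (growing_recurrence mu n Hmu) as Hu.
  destruct (Nat.eqb_spec (S n) j) as [<-|Hne].
  - rewrite (green_le mu n), (green_le mu (S n)), (green_ge mu (S (S n))) by lia.
    replace (S (S n) + S n)%nat with (S (2 * (S n))) by lia.
    rewrite pow_1_odd, <- (casoratian mu n Hmu).
    replace (mu * (bessel_I mu n * growing mu (S n)
                   + bessel_I mu (S n) * growing mu n))
      with (mu * bessel_I mu n * growing mu (S n)
            + mu * (bessel_I mu (S n) * growing mu n)) by ring.
    rewrite HI. ring.
  - destruct (Nat.lt_ge_cases (S n) j) as [Hlt|Hge].
    + rewrite !green_le by lia.
      replace (mu * (growing mu (S (S n)) * bessel_I mu j))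
        with (mu * growing mu (S (S n)) * bessel_I mu j) by ring.
      rewrite Hu. ring.
    + rewrite !green_ge by lia.
      cbn [Nat.add]. rewrite <- !tech_pow_Rmult.
      replace (mu * ((-1) ^ (n + j) * (growing mu j * bessel_I mu n)))
        with ((-1) ^ (n + j) * growing mu j * (mu * bessel_I mu n)) by ring.
      rewrite HI. ring.
Qed.

Lemma green_abs_le mu n j : 0 < mu -> (n <= j)%nat ->
  Rabs (green mu n j) = growing mu n * bessel_I mu j.
Proof.
  intros Hmu H. rewrite green_le by exact H.
  apply Rabs_pos_eq, Rmult_le_pos; [apply growing_ge0|apply bessel_I_ge0]; lra.
Qed.

Lemma green_abs_ge mu n j : 0 < mu -> (j <= n)%nat ->
  Rabs (green mu n j) = growing mu j * bessel_I mu n.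
Proof.
  intros Hmu H. rewrite green_ge by exact H.
  rewrite Rabs_mult, pow_1_abs, Rmult_1_l.
  apply Rabs_pos_eq, Rmult_le_pos; [apply growing_ge0|apply bessel_I_ge0]; lra.
Qed.

(** For [n > q] one has [2 (q + 1) I_n <= 2 n I_n = mu (I_(n-1) - I_(n+1))],
    which telescopes.  The starting point [q] is free, because the first column
    needs a better constant than [q = j - 1] would give. *)
Lemma green_column_tail mu j q m : 0 < mu -> (j <= S q)%nat ->
  2 * sum_n (fun n => Rabs (green mu n j)) (q + m)
  <= 2 * sum_n (fun n => Rabs (green mu n j)) q
     + mu / INR (S q) * (growing mu j * (bessel_I mu q + bessel_I mu (S q))).
Proof.
  intros Hmu Hj. assert (Hmu' := Rlt_le _ _ Hmu).
  pose proof (growing_ge0 mu j Hmu) as Hg.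
  assert (Hq : 0 < INR (S q)) by (apply lt_0_INR; lia).
  assert (Hmq : 0 <= mu / INR (S q)) by (left; apply Rdiv_lt_0_compat; lra).
  assert (H : 2 * sum_n (fun n => Rabs (green mu n j)) (q + m)
    + mu / INR (S q)
      * (growing mu j * (bessel_I mu (q + m) + bessel_I mu (S (q + m))))
    <= 2 * sum_n (fun n => Rabs (green mu n j)) q
     + mu / INR (S q) * (growing mu j * (bessel_I mu q + bessel_I mu (S q)))).
  { induction m as [|m IH]; [rewrite Nat.add_0_r; lra|].
    rewrite Nat.add_succ_r, sum_n_S, green_abs_ge by (assumption || lia).
    apply Rle_trans with (2 := IH).
    set (k := (q + m)%nat).
    pose proof (bessel_I_recurrence mu k Hmu') as HI.
    pose proof (bessel_I_ge0 mu (S k) Hmu') as HIk.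
    assert (Hk : INR (S q) <= INR (S k)) by (apply le_INR; unfold k; lia).
    assert (Hc : 2 * bessel_I mu (S k)
      <= mu / INR (S q) * (bessel_I mu k - bessel_I mu (S (S k)))).
    { apply Rmult_le_reg_l with (INR (S q)); [exact Hq|].
      replace (INR (S q)
               * (mu / INR (S q) * (bessel_I mu k - bessel_I mu (S (S k)))))
        with (mu * bessel_I mu k - mu * bessel_I mu (S (S k))) by (field; lra).
      nra. }
    apply Rmult_le_compat_l with (r := growing mu j) in Hc; [|exact Hg].
    nra. }
  pose proof (bessel_I_ge0 mu (q + m) Hmu').
  pose proof (bessel_I_ge0 mu (S (q + m)) Hmu').
  assert (0 <= mu / INR (S q)
    * (growing mu j * (bessel_I mu (q + m) + bessel_I mu (S (q + m)))))
    by (apply Rmult_le_pos; [exact Hmq|apply Rmult_le_pos; lra]).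
  lra.
Qed.

Lemma green_column_head mu p : 0 < mu ->
  sum_n (fun n => Rabs (green mu n (S p))) p
  = bessel_I mu (S p) * sum_n (growing mu) p.
Proof.
  intros Hmu.
  transitivity (sum_n (fun n => mult (bessel_I mu (S p)) (growing mu n)) p).
  - apply sum_n_ext_loc. intros n Hn.
    rewrite green_abs_le by (assumption || lia). apply Rmult_comm.
  - exact (sum_n_mult_l (bessel_I mu (S p)) (growing mu) p).
Qed.

(** The normalization is [mu u_1 I_0 = 1].  With the tail estimated from [n = 2]
    on, the claim becomes [2 I_1 + (mu / 2) (I_1 + I_2) <= 1.45 mu I_0], and the
    recurrence reduces it to a quadratic inequality in [mu]. *)
Lemma green_column_first mu N : 0 < mu ->
  2 * sum_n (fun n => Rabs (green mu n 1)) N <= 1.45.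
Proof.
  intros Hmu. assert (Hmu' := Rlt_le _ _ Hmu).
  apply Rle_trans with (2 * sum_n (fun n => Rabs (green mu n 1)) (1 + N)).
  { rewrite Nat.add_comm. apply Rmult_le_compat_l; [lra|].
    apply sum_n_nonneg_mono. intros; apply Rabs_pos. }
  apply Rle_trans with (1 := green_column_tail mu 1 1 N Hmu ltac:(lia)).
  rewrite sum_n_S, green_column_head, sum_O, growing_0 by exact Hmu.
  rewrite green_abs_ge by (assumption || lia).
  pose proof (casoratian mu 0 Hmu) as HW. rewrite growing_0 in HW.
  pose proof (bessel_I_recurrence mu 0 Hmu') as H0.
  pose proof (bessel_I_recurrence mu 1 Hmu') as H1.
  pose proof (bessel_I_decreasing mu 2 Hmu) as D2.
  pose proof (bessel_I_ge0 mu 1 Hmu') as P1.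
  pose proof (bessel_I_ge0 mu 2 Hmu') as P2.
  pose proof (growing_ge0 mu 1 Hmu) as G1.
  simpl (INR 1) in *. replace (INR 2) with 2 in * by (simpl; ring).
  set (u := growing mu 1) in *.
  set (I0 := bessel_I mu 0) in *. set (I1 := bessel_I mu 1) in *.
  set (I2 := bessel_I mu 2) in *. set (I3 := bessel_I mu 3) in *.
  assert (HI : (mu / 2 - 0.9) * I1 <= 0.95 * mu * I2).
  { destruct (Rle_dec mu 1.8); [nra|].
    apply Rmult_le_reg_l with mu; [assumption|].
    (* This uses [mu I_1 = 4 I_2 + mu I_3] and [I_3 <= I_2]. *)
    assert (mu * I1 <= (4 + mu) * I2) by nra.
    assert ((mu / 2 - 0.9) * (mu * I1) <= (mu / 2 - 0.9) * ((4 + mu) * I2))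
      by (apply Rmult_le_compat_l; lra).
    assert (0 <= I2 * (0.45 * mu * mu - 1.1 * mu + 3.6)) by (apply Rmult_le_pos; nra).
    nra. }
  assert (HC : 2 * I1 + mu / 2 * (I1 + I2) <= 1.45 * (mu * I0)) by lra.
  apply Rmult_le_compat_l with (r := u) in HC; [|exact G1].
  lra.
Qed.

Lemma green_column_head_le mu p : 0 < mu ->
  2 * sum_n (fun n => Rabs (green mu n (S (S p)))) (S p) <= 1 / 2.
Proof.
  intros Hmu. assert (Hmu' := Rlt_le _ _ Hmu).
  rewrite green_column_head by exact Hmu.
  pose proof (growing_partial_sum mu p Hmu) as HS.
  pose proof (casoratian mu (S p) Hmu) as HW.
  pose proof (bessel_I_recurrence mu (S p) Hmu') as HI.
  pose proof (bessel_I_decreasing mu (S p) Hmu) as HD.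
  pose proof (bessel_I_ge0 mu (S (S p)) Hmu') as P2.
  pose proof (bessel_I_ge0 mu (S (S (S p))) Hmu') as P3.
  pose proof (growing_ge0 mu (S (S p)) Hmu) as G2.
  assert (HM : bessel_I mu (S (S p)) * Rmax mu (2 * INR (S (S p)))
               <= mu * bessel_I mu (S p)).
  { unfold Rmax. destruct Rle_dec; nra. }
  apply Rmult_le_compat_l with (r := bessel_I mu (S (S p))) in HS; [|exact P2].
  apply Rmult_le_compat_r with (r := growing mu (S (S p))) in HM; [|exact G2].
  nra.
Qed.

(** For [j = 2] the tail bound is already 1.  The Casoratian gives
    [(mu + 8 / mu) I_2 u_1 <= 1], and [mu + 8 / mu >= 5]. *)
Lemma green_column_second_head mu : 0 < mu ->
  2 * sum_n (fun n => Rabs (green mu n 2)) 1 <= 0.45.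
Proof.
  intros Hmu. assert (Hmu' := Rlt_le _ _ Hmu).
  rewrite green_column_head, sum_n_S, sum_O, growing_0 by exact Hmu.
  pose proof (casoratian mu 1 Hmu) as HW.
  pose proof (growing_recurrence mu 0 Hmu) as HU. rewrite growing_0 in HU.
  pose proof (bessel_I_recurrence mu 1 Hmu') as HI.
  pose proof (bessel_I_ge0 mu 2 Hmu') as P2.
  pose proof (bessel_I_ge0 mu 3 Hmu') as P3.
  pose proof (growing_ge0 mu 1 Hmu) as G1.
  pose proof (growing_ge0 mu 2 Hmu) as G2.
  simpl (INR 1) in *. replace (INR 2) with 2 in * by (simpl; ring).
  set (u1 := growing mu 1) in *. set (u2 := growing mu 2) in *.
  set (I1 := bessel_I mu 1) in *. set (I2 := bessel_I mu 2) in *.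
  assert (A : 4 * I2 * u2 + mu * (I2 * u1) <= 1).
  { assert (4 * I2 * u2 <= mu * I1 * u2) by (apply Rmult_le_compat_r; nra). nra. }
  assert (B : mu * (4 * I2 * u2) = 8 * (I2 * u1)).
  { replace (mu * (4 * I2 * u2)) with (4 * I2 * (mu * u2)) by ring.
    rewrite HU. ring. }
  assert (P : 0 <= I2 * u1) by nra.
  assert (C : (mu * mu + 8) * (I2 * u1) <= mu).
  { apply Rmult_le_compat_l with (r := mu) in A; lra. }
  assert (Hq : 0 <= (mu * mu + 8 - 5 * mu) * (I2 * u1)).
  { apply Rmult_le_pos; [|exact P]. pose proof (Rle_0_sqr (mu - 5 / 2)) as Hs.
    unfold Rsqr in Hs. lra. }
  assert (I2 * u1 <= 1 / 5) by (apply Rmult_le_reg_l with mu; lra).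
  lra.
Qed.

(** Column [p + 1]; the factor 2 is the weight of the norm, and the entry at
    [n = 0] vanishes. *)
Lemma green_column_bound mu p N : 0 < mu ->
  2 * sum_n (fun n => Rabs (green mu n (S p))) N <= 1.45.
Proof.
  intros Hmu. assert (Hmu' := Rlt_le _ _ Hmu).
  destruct p as [|p]; [apply green_column_first; exact Hmu|].
  apply Rle_trans with
    (2 * sum_n (fun n => Rabs (green mu n (S (S p)))) (S p + N)).
  { rewrite Nat.add_comm. apply Rmult_le_compat_l; [lra|].
    apply sum_n_nonneg_mono. intros; apply Rabs_pos. }
  apply Rle_trans with (1 := green_column_tail mu (S (S p)) (S p) N Hmu ltac:(lia)).
  pose proof (casoratian mu (S p) Hmu) as HW.
  pose proof (bessel_I_decreasing mu (S p) Hmu) as HD.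
  pose proof (bessel_I_ge0 mu (S (S p)) Hmu') as P2.
  pose proof (growing_ge0 mu (S p) Hmu) as G1.
  pose proof (growing_ge0 mu (S (S p)) Hmu) as G2.
  assert (Hj : 2 <= INR (S (S p))) by (apply (le_INR 2); lia).
  assert (HT : mu / INR (S (S p)) * (growing mu (S (S p)) *
      (bessel_I mu (S p) + bessel_I mu (S (S p)))) <= 2 / INR (S (S p))).
  { apply Rmult_le_reg_l with (INR (S (S p))); [lra|].
    replace (INR (S (S p)) * (2 / INR (S (S p)))) with 2 by (field; lra).
    replace (INR (S (S p)) * (mu / INR (S (S p)) * (growing mu (S (S p)) *
      (bessel_I mu (S p) + bessel_I mu (S (S p))))))
      with (mu * (growing mu (S (S p))
                  * (bessel_I mu (S p) + bessel_I mu (S (S p)))))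
      by (field; lra).
    assert (0 <= mu * (bessel_I mu (S (S p)) * growing mu (S p)))
      by (repeat apply Rmult_le_pos; assumption).
    assert (mu * (growing mu (S (S p)) * bessel_I mu (S (S p)))
      <= mu * (growing mu (S (S p)) * bessel_I mu (S p)))
      by (repeat apply Rmult_le_compat_l; assumption).
    lra. }
  destruct p as [|p].
  - pose proof (green_column_second_head mu Hmu).
    replace (INR 2) with 2 in HT at 2 by (simpl; ring).
    lra.
  - pose proof (green_column_head_le mu (S p) Hmu).
    assert (H3 : 3 <= INR (S (S (S p))))
      by (replace 3 with (INR 3) by (simpl; ring); apply le_INR; lia).
    assert (2 / INR (S (S (S p))) <= 2 / 3).
    { unfold Rdiv. apply Rmult_le_compat_l; [lra|]. apply Rinv_le_contravar; lra. }
    lra.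
Qed.

(** * Solving the rows of positive index *)

(** The norm estimate is the column bound after exchanging a finite sum over
    rows with the series over columns.  The constant is compared with
    [sum_(j >= 1) |z_j|], half of the share that these entries have in the norm
    of [z]: the other half pays for the correction of row 0. *)
Lemma green_solution mu z : 0 < mu -> in_ell1 z ->
  exists w, in_ell1 w /\ (forall n, L mu w (S n) = z (S n)) /\
    norm_ell1 w <= 1.45 * Series (fun j => Rabs (z (S j))).
Proof.
  intros Hmu Hz.
  set (t := fun n j => green mu n (S j) * z (S j)).
  assert (Hg : forall n j, Rabs (green mu n (S j)) <= 1.45).
  { intros n j. pose proof (green_column_bound mu j n Hmu) as H.
    pose proof (term_le_sum_n (fun n => Rabs (green mu n (S j))) n
      (fun _ => Rabs_pos _)) as Hn. cbv beta in Hn.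
    pose proof (Rabs_pos (green mu n (S j))). lra. }
  assert (Habs : forall n, ex_series (fun j => Rabs (t n j))).
  { intros n.
    apply ex_series_dominated with (fun j => 1.45 * Rabs (z (S j)));
      [|apply ex_series_Rmult; exact Hz].
    intros j. rewrite Rabs_Rabsolu. unfold t. rewrite Rabs_mult.
    apply Rmult_le_compat_r; [apply Rabs_pos|apply Hg]. }
  assert (Hex : forall n, ex_series (t n)) by (intros n; apply ex_series_Rabs, Habs).
  set (w := fun n => Series (t n)).
  assert (Hw0 : w O = 0).
  { unfold w, t. rewrite (Series_ext _ (fun j => 0 * z (S j))).
    - rewrite Series_scal_l. ring.
    - intros j. rewrite green_le by lia. rewrite growing_0. ring. }
  assert (Hsum : forall N, sum_n (fun n => Rabs (w (S n))) N
    <= 1.45 / 2 * Series (fun j => Rabs (z (S j)))).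
  { intros N.
    destruct (sum_n_Series_swap (fun n j => Rabs (t (S n) j)) N
      (fun n => Habs (S n))) as [Hex2 Heq].
    apply Rle_trans with (sum_n (fun n => Series (fun j => Rabs (t (S n) j))) N).
    { apply sum_n_m_le. intros n. apply Series_Rabs, Habs. }
    rewrite Heq, <- Series_scal_l.
    apply Series_le; [|apply ex_series_Rmult; exact Hz].
    intros j. split.
    { apply sum_n_nonneg. intros; apply Rabs_pos. }
    rewrite (sum_n_ext _ (fun n => mult (Rabs (green mu (S n) (S j))) (Rabs (z (S j)))))
      by (intros n; unfold t; apply Rabs_mult).
    rewrite sum_n_mult_r. unfold mult; simpl.
    apply Rmult_le_compat_r; [apply Rabs_pos|].
    pose proof (green_column_bound mu j (S N) Hmu) as H.
    assert (Hshift : forall k,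
      Rabs (green mu 0 (S j)) + sum_n (fun n => Rabs (green mu (S n) (S j))) k
      = sum_n (fun n => Rabs (green mu n (S j))) (S k)).
    { induction k as [|k IH]; [now rewrite sum_n_S, !sum_O|].
      rewrite !sum_n_S. rewrite sum_n_S in IH. now rewrite <- Rplus_assoc, IH. }
    rewrite <- Hshift in H. pose proof (Rabs_pos (green mu 0 (S j))).
    change (sum_n (fun n => Rabs (green mu (S n) (S j))) N <= 1.45 / 2). lra. }
  destruct (summable_of_bounded _ _ (fun n => Rabs_pos (w (S n))) Hsum) as [Hin Hle].
  exists w. split; [exact Hin|split].
  - intros n. cbn [L]. unfold w.
    rewrite <- !Series_scal_l.
    rewrite <- Series_plus by (apply ex_series_Rmult, Hex).
    rewrite <- Series_minus by
      (try apply ex_series_Rplus; apply ex_series_Rmult, Hex).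
    rewrite <- (Series_delta (fun j => z (S j)) n).
    apply Series_ext. intros j. unfold t.
    change (n =? j)%nat with (S n =? S j)%nat.
    rewrite <- (green_equation mu n (S j) Hmu). ring.
  - unfold norm_ell1. rewrite Hw0, Rabs_R0. lra.
Qed.

(** The Green kernel degenerates at [mu = 0], where the Casoratian cannot be
    normalized. *)
Lemma diagonal_solution z : in_ell1 z ->
  exists w, in_ell1 w /\ (forall n, L 0 w (S n) = z (S n)) /\
    norm_ell1 w <= 1.45 * Series (fun j => Rabs (z (S j))).
Proof.
  intros Hz.
  set (w := fun n => match n with O => 0 | S i => z (S i) / (2 * INR (S i)) end).
  assert (Hj : forall j, 1 <= INR (S j)) by (intros j; apply (le_INR 1); lia).
  assert (Hb : forall j, 0 <= Rabs (w (S j)) <= / 2 * Rabs (z (S j))).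
  { intros j. split; [apply Rabs_pos|]. unfold w.
    unfold Rdiv. rewrite Rabs_mult, Rmult_comm.
    apply Rmult_le_compat_r; [apply Rabs_pos|]. specialize (Hj j).
    rewrite Rabs_pos_eq by (left; apply Rinv_0_lt_compat; lra).
    apply Rinv_le_contravar; lra. }
  assert (Hex := ex_series_Rmult (/ 2) _ Hz).
  exists w. split; [|split].
  - unfold in_ell1.
    apply ex_series_dominated with (2 := Hex).
    intros j. rewrite Rabs_Rabsolu. apply Hb.
  - intros n. cbn [L]. unfold w at 2. specialize (Hj n). field. lra.
  - unfold norm_ell1. unfold w at 1. rewrite Rabs_R0.
    pose proof (Series_le _ _ Hb Hex) as H. rewrite Series_scal_l in H.
    pose proof (ell1_tail_ge0 z Hz). lra.
Qed.

(** * Linearity and row 0 *)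

Definition comb (a : R) (y w : nat -> R) (n : nat) : R := a * y n + w n.

Lemma Rabs_signed n x : Rabs ((-1) ^ n * x) = Rabs x.
Proof. rewrite Rabs_mult, pow_1_abs. ring. Qed.

Lemma alternating_ex_series y : in_ell1 y -> ex_series (fun i => (-1) ^ S i * y (S i)).
Proof.
  intros Hy. apply ex_series_Rabs.
  apply ex_series_ext with (2 := Hy). intros n. now rewrite Rabs_signed.
Qed.

Lemma in_ell1_comb a y w : in_ell1 y -> in_ell1 w -> in_ell1 (comb a y w).
Proof.
  intros Hy Hw. unfold in_ell1, comb.
  apply ex_series_dominated with
    (fun j => Rabs a * Rabs (y (S j)) + Rabs (w (S j))).
  - intros j. rewrite Rabs_Rabsolu, <- Rabs_mult. apply Rabs_triang.
  - apply ex_series_Rplus; [apply ex_series_Rmult|]; assumption.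
Qed.

Lemma norm_comb_le a y w : in_ell1 y -> in_ell1 w ->
  norm_ell1 (comb a y w) <= Rabs a * norm_ell1 y + norm_ell1 w.
Proof.
  intros Hy Hw. unfold norm_ell1.
  assert (H : Series (fun j => Rabs (comb a y w (S j)))
    <= Series (fun j => Rabs a * Rabs (y (S j)) + Rabs (w (S j)))).
  { apply Series_le.
    - intros j. split; [apply Rabs_pos|]. unfold comb.
      rewrite <- Rabs_mult. apply Rabs_triang.
    - apply ex_series_Rplus; [apply ex_series_Rmult|]; assumption. }
  rewrite Series_plus, Series_scal_l in H
    by (try apply ex_series_Rmult; assumption).
  assert (H0 : Rabs (comb a y w 0) <= Rabs a * Rabs (y 0%nat) + Rabs (w 0%nat))
    by (unfold comb; rewrite <- Rabs_mult; apply Rabs_triang).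
  lra.
Qed.

Lemma L_comb mu a y w : in_ell1 y -> in_ell1 w ->
  forall n, L mu (comb a y w) n = comb a (L mu y) (L mu w) n.
Proof.
  intros Hy Hw [|n]; unfold comb; cbn [L]; [|ring].
  rewrite (Series_ext (fun i => (-1) ^ S i * (a * y (S i) + w (S i)))
    (fun i => a * ((-1) ^ S i * y (S i)) + (-1) ^ S i * w (S i)))
    by (intros; ring).
  rewrite Series_plus, Series_scal_l
    by (try apply ex_series_Rmult; apply alternating_ex_series; assumption).
  ring.
Qed.

Lemma L_row0_le mu y : in_ell1 y -> Rabs (L mu y 0) <= norm_ell1 y.
Proof.
  intros Hy. cbn [L]. unfold norm_ell1.
  apply Rle_trans with (1 := Rabs_triang _ _).
  rewrite Rabs_mult, (Rabs_pos_eq 2) by lra.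
  assert (H : Rabs (Series (fun i => (-1) ^ S i * y (S i)))
              <= Series (fun j => Rabs (y (S j)))).
  { rewrite <- (Series_ext (fun i => Rabs ((-1) ^ S i * y (S i)))
      (fun j => Rabs (y (S j)))) by (intros; apply Rabs_signed).
    apply Series_Rabs, ex_series_ext with (2 := Hy).
    intros n. now rewrite Rabs_signed. }
  lra.
Qed.

(** * The boundary layer *)

(** Up to the factor [exp mu], the Chebyshev coefficients of
    [exp (- mu (x + 1))]. *)
Definition boundary_layer (mu : R) (n : nat) : R := (-1) ^ n * bessel_I mu n.

Lemma boundary_layer_in_ell1 mu : 0 <= mu -> in_ell1 (boundary_layer mu).
Proof.
  intros Hmu. unfold in_ell1.
  apply ex_series_ext with (2 := bessel_I_summable mu Hmu).
  intros n. unfold boundary_layer. rewrite Rabs_signed.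
  symmetry. apply Rabs_pos_eq, bessel_I_ge0, Hmu.
Qed.

Lemma L_boundary_layer_pos mu n : 0 <= mu -> L mu (boundary_layer mu) (S n) = 0.
Proof.
  intros Hmu. cbn [L]. unfold boundary_layer. rewrite <- !tech_pow_Rmult.
  pose proof (bessel_I_recurrence mu n Hmu) as H.
  replace (mu * ((-1) ^ n * bessel_I mu n))
    with ((-1) ^ n * (mu * bessel_I mu n)) by ring.
  rewrite H. ring.
Qed.

(** The signs of the boundary layer cancel those of row 0.  This is why
    correcting row 0 by a given amount costs exactly that amount in norm. *)
Lemma L_boundary_layer_0 mu : 0 <= mu ->
  L mu (boundary_layer mu) 0 = norm_ell1 (boundary_layer mu).
Proof.
  intros Hmu. cbn [L]. unfold norm_ell1, boundary_layer. f_equal.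
  - simpl. rewrite Rmult_1_l, Rabs_pos_eq; [reflexivity|apply bessel_I_ge0, Hmu].
  - f_equal. apply Series_ext. intros i.
    rewrite Rabs_signed, Rabs_pos_eq by (apply bessel_I_ge0, Hmu).
    rewrite <- Rmult_assoc, <- Rpow_mult_distr.
    replace (-1 * -1) with 1 by ring. rewrite pow1. ring.
Qed.

Lemma boundary_layer_norm_gt0 mu : 0 <= mu -> 0 < norm_ell1 (boundary_layer mu).
Proof.
  intros Hmu. pose proof (bessel_I0_gt0 mu Hmu) as H0.
  pose proof (ell1_tail_ge0 _ (boundary_layer_in_ell1 mu Hmu)).
  unfold norm_ell1.
  assert (0 < Rabs (boundary_layer mu 0)).
  { apply Rabs_pos_lt. unfold boundary_layer. simpl. lra. }
  lra.
Qed.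

(** * Uniqueness *)

Lemma in_ell1_lim y : in_ell1 y -> is_lim_seq y 0.
Proof.
  intros Hy. apply is_lim_seq_incr_1.
  apply (ex_series_lim_0 (fun j => y (S j))). apply ex_series_Rabs, Hy.
Qed.

(** Multiply row [n] by [y_n] and sum: the off-diagonal terms telescope to
    [mu y_N y_(N+1)], since the contribution [mu y_0 y_1] vanishes.  The
    nonnegative diagonal terms therefore have sum 0. *)
Lemma homogeneous_zero mu y : in_ell1 y -> y 0%nat = 0 ->
  (forall n, L mu y (S n) = 0) -> forall n, y n = 0.
Proof.
  intros Hy Hy0 HL.
  assert (Henergy : forall N,
    mu * (y (S N) * y (S (S N)))
    = sum_n (fun i => 2 * INR (S i) * (y (S i) * y (S i))) N).
  { induction N as [|N IH].
    - rewrite sum_O. specialize (HL O). cbn [L] in HL. rewrite Hy0 in HL.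
      replace (2 * INR 1 * (y 1%nat * y 1%nat))
        with ((2 * INR 1 * y 1%nat) * y 1%nat) by ring.
      replace (2 * INR 1 * y 1%nat) with (mu * y 2%nat) by lra. ring.
    - rewrite sum_n_S, <- IH. specialize (HL (S N)). cbn [L] in HL.
      set (c := INR (S (S N))) in *.
      replace (2 * c * (y (S (S N)) * y (S (S N))))
        with ((2 * c * y (S (S N))) * y (S (S N))) by ring.
      replace (2 * c * y (S (S N)))
        with (mu * y (S (S (S N))) - mu * y (S N)) by lra.
      ring. }
  set (a := fun i => 2 * INR (S i) * (y (S i) * y (S i))) in *.
  assert (Ha : forall i, 0 <= a i).
  { intros i. unfold a. pose proof (pos_INR (S i)).
    apply Rmult_le_pos; [lra|apply Rle_0_sqr]. }
  assert (Hlim : is_series a 0).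
  { change (is_lim_seq (sum_n a) 0).
    apply (is_lim_seq_ext (fun N => mu * (y (S N) * y (S (S N)))));
      [intros N; apply Henergy|].
    assert (L1 : is_lim_seq (fun N => y (S N)) 0)
      by (apply (is_lim_seq_incr_1 y), in_ell1_lim, Hy).
    assert (L2 : is_lim_seq (fun N => y (S (S N))) 0)
      by (apply (is_lim_seq_incr_1 (fun N => y (S N))), L1).
    replace (Finite 0) with (Finite (mu * (0 * 0))) by (f_equal; ring).
    apply is_lim_seq_mult'; [apply is_lim_seq_const|].
    apply is_lim_seq_mult'; assumption. }
  intros [|n]; [exact Hy0|].
  pose proof (term_le_Series a n Ha (ex_intro _ 0 Hlim)) as H.
  rewrite (is_series_unique _ _ Hlim) in H. unfold a in H.
  assert (1 <= INR (S n)) by (apply (le_INR 1); lia).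
  assert (y (S n) * y (S n) = 0).
  { pose proof (Rle_0_sqr (y (S n))) as Hs. unfold Rsqr in Hs. nra. }
  now apply Rsqr_0_uniq.
Qed.

(** Subtracting a multiple of the boundary layer reduces to [y_0 = 0]; row 0
    then shows that this multiple is 0. *)
Lemma L_injective mu y : 0 <= mu -> in_ell1 y ->
  (forall n, L mu y n = 0) -> forall n, y n = 0.
Proof.
  intros Hmu Hy HL.
  pose proof (bessel_I0_gt0 mu Hmu) as H0.
  pose proof (boundary_layer_in_ell1 mu Hmu) as Hv.
  set (v := boundary_layer mu) in *.
  set (a := - (y 0%nat / bessel_I mu 0)).
  assert (Hd : forall n, comb a v y n = 0).
  { apply (homogeneous_zero mu); [now apply in_ell1_comb| |].
    - unfold comb, a, v, boundary_layer. simpl. field. lra.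
    - intros n. rewrite L_comb by assumption. unfold comb, v.
      rewrite L_boundary_layer_pos, HL by exact Hmu. ring. }
  assert (Ha : a = 0).
  { pose proof (L_comb mu a v y Hv Hy 0) as H.
    pose proof (L_row0_le mu _ (in_ell1_comb a v y Hv Hy)) as Hr.
    unfold norm_ell1 in Hr. rewrite Hd in Hr.
    rewrite (Series_ext _ (fun _ => 0 * 0)) in Hr
      by (intros; rewrite Hd, Rabs_R0; ring).
    rewrite Series_scal_l, Rabs_R0 in Hr.
    assert (HL0 : L mu (comb a v y) 0 = 0).
    { apply Rabs_eq_0. pose proof (Rabs_pos (L mu (comb a v y) 0)). lra. }
    rewrite HL0 in H. unfold comb in H. rewrite HL in H. unfold v in H.
    rewrite L_boundary_layer_0 in H by exact Hmu.
    pose proof (boundary_layer_norm_gt0 mu Hmu).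
    destruct (Rmult_integral a (norm_ell1 (boundary_layer mu))); lra. }
  intros n. specialize (Hd n). unfold comb in Hd. rewrite Ha in Hd. lra.
Qed.

Lemma L_solution_unique mu y y' : 0 <= mu -> in_ell1 y -> in_ell1 y' ->
  L mu y = L mu y' -> y = y'.
Proof.
  intros Hmu Hy Hy' Heq. apply functional_extensionality. intros n.
  assert (H : comb (-1) y y' n = 0).
  { apply (L_injective mu); [exact Hmu|now apply in_ell1_comb|].
    intros k. rewrite L_comb by assumption. unfold comb. rewrite Heq. ring. }
  unfold comb in H. lra.
Qed.

(** * The inverse *)

Lemma L_surjective mu z : 0 <= mu -> in_ell1 z ->
  exists y, in_ell1 y /\ L mu y = z /\ norm_ell1 y <= 1.45 * norm_ell1 z.
Proof.
  intros Hmu Hz.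
  assert (Hw : exists w, in_ell1 w /\ (forall n, L mu w (S n) = z (S n)) /\
    norm_ell1 w <= 1.45 * Series (fun j => Rabs (z (S j)))).
  { destruct (Rle_lt_or_eq_dec 0 mu Hmu) as [Hpos|<-];
      [now apply green_solution|now apply diagonal_solution]. }
  destruct Hw as [w [Hin [Hrow Hnorm]]].
  pose proof (boundary_layer_in_ell1 mu Hmu) as Hv.
  pose proof (boundary_layer_norm_gt0 mu Hmu) as HN.
  set (v := boundary_layer mu) in *.
  set (b := (z 0%nat - L mu w 0) / norm_ell1 v).
  exists (comb b v w). split; [now apply in_ell1_comb|split].
  - apply functional_extensionality. intros n. rewrite L_comb by assumption.
    unfold comb, b. destruct n as [|n].
    + unfold v at 2. rewrite L_boundary_layer_0 by exact Hmu. fold v. field. lra.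
    + unfold v at 2. rewrite L_boundary_layer_pos, Hrow by exact Hmu. ring.
  - apply Rle_trans with (1 := norm_comb_le b v w Hv Hin).
    assert (Hb : Rabs b * norm_ell1 v <= Rabs (z 0%nat) + norm_ell1 w).
    { replace (Rabs b * norm_ell1 v) with (Rabs (z 0%nat - L mu w 0)).
      - pose proof (L_row0_le mu w Hin). unfold Rminus.
        apply Rle_trans with (1 := Rabs_triang _ _). rewrite Rabs_Ropp. lra.
      - unfold b, Rdiv. rewrite Rabs_mult, (Rabs_pos_eq (/ norm_ell1 v))
          by (left; apply Rinv_0_lt_compat, HN).
        field. lra. }
    unfold norm_ell1 at 3. pose proof (Rabs_pos (z 0%nat)). lra.
Qed.

Lemma Linv_spec mu z : 0 <= mu -> in_ell1 z ->
  in_ell1 (Linv mu z) /\ L mu (Linv mu z) = z.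
Proof.
  intros Hmu Hz. apply (epsilon_spec (inhabits (fun _ : nat => 0))
    (fun y => in_ell1 y /\ L mu y = z)).
  destruct (L_surjective mu z Hmu Hz) as [y [Hy [HL _]]]. now exists y.
Qed.

Lemma Linv_norm_le mu z : 0 <= mu -> in_ell1 z ->
  norm_ell1 (Linv mu z) <= 1.45 * norm_ell1 z.
Proof.
  intros Hmu Hz.
  destruct (L_surjective mu z Hmu Hz) as [y [Hy [HL Hn]]].
  destruct (Linv_spec mu z Hmu Hz) as [Hi HLi].
  replace (Linv mu z) with y; [exact Hn|].
  apply (L_solution_unique mu); [assumption..|]. now rewrite HL, HLi.
Qed.

Theorem corollary3p3 : forall mu : R, 0 <= mu <= 1000 ->
  (forall z : nat -> R, in_ell1 z ->
     exists! y : nat -> R, in_ell1 y /\ L mu y = z) /\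
  is_bounded_operator (Linv mu) /\
  Rbar_le (op_norm (Linv mu)) (Finite 1.45).
Proof.
  intros mu [Hmu _]. split; [|split].
  - intros z Hz. destruct (L_surjective mu z Hmu Hz) as [y [Hy [HL _]]].
    exists y. split; [now split|]. intros y' [Hy' HL'].
    apply (L_solution_unique mu); [assumption..|]. now rewrite HL, HL'.
  - split; [|split].
    + intros z Hz. now apply Linv_spec.
    + intros a z w Hz Hw.
      destruct (Linv_spec mu z Hmu Hz) as [Hiz HLz].
      destruct (Linv_spec mu w Hmu Hw) as [Hiw HLw].
      destruct (Linv_spec mu (comb a z w) Hmu (in_ell1_comb a z w Hz Hw)) as [Hi HL].
      change (Linv mu (comb a z w) = comb a (Linv mu z) (Linv mu w)).
      apply (L_solution_unique mu); [assumption..|now apply in_ell1_comb|].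
      rewrite HL. apply functional_extensionality. intros n.
      rewrite L_comb by assumption. unfold comb. now rewrite HLz, HLw.
    + exists 1.45. intros z Hz. now apply Linv_norm_le.
  - apply (Lub_Rbar_correct _). intros r [z [Hz [H1 ->]]].
    pose proof (Linv_norm_le mu z Hmu Hz). simpl. lra.
Qed.
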